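(* Let $(X,E,B,\tilde B)$ be a natural admissible quadruple and suppose $\tilde B$ is semisimple. Then $\tilde B$ has bounded relative units if and only if both $E$ and $B$ have bounded relative units.
   Context: Banach algebras are over $\mathbb{C}$. For a commutative Banach algebra $A$ with unit, $M(A)$ is the set of nonzero multiplicative linear functionals $A\to\mathbb{C}$ with the relative weak-star topology from $A^*$, and $\hat a(\phi)=\phi(a)$ for $a\in A$, $\phi\in M(A)$. $A$ is semisimple if $a\mapsto\hat a$ is injective. For $\phi\in M(A)$, $J_\phi=\{a\in A:\phi\notin\mathrm{supp}(a)\}$, where $\mathrm{supp}(a)$ is the closure in $M(A)$ of $\{\chi\in M(A):\hat a(\chi)\ne0\}$. $A$ has bounded relative units if for every $\phi\in M(A)$ there exists $m_\phi>0$ such that for each compact subset $K$ of $M(A)\setminus\{\phi\}$ there exists $a\in J_\phi$ with $\hat a(K)\subset\{1\}$ and $\|a\|\le m_\phi$. $C(X,E)$ is the algebra of all continuous maps $X\to E$ with pointwise operations, and $C(X)=C(X,\mathbb{C})$. An $E$-valued function algebra on $X$ is a subalgebra $A\subset C(X,E)$, equipped with some norm that makes it complete, such that (1) $A$ contains the constant function $x\mapsto 1_E$; (2) $A$ separates the points of $X$; (3) for each $x\in X$ the evaluation map $e_x:A\to E$, $f\mapsto f(x)$, is continuous. A $\mathbb{C}$-valued function algebra $B$ on $X$ is natural if every element of $M(B)$ is evaluation at a point of $X$. An admissible quadruple is a quadruple $(X,E,B,\tilde B)$ where: $X$ is a compact Hausdorff space; $E$ is a commutative Banach algebra with unit; $B\subset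 C(X)$ is a natural $\mathbb{C}$-valued function algebra on $X$; $\tilde B\subset C(X,E)$ is an $E$-valued function algebra on $X$; $B\cdot E\subset\tilde B$ (that is, $x\mapsto g(x)a$ belongs to $\tilde B$ for all $g\in B$, $a\in E$); and $\{\lambda\circ f: f\in\tilde B,\ \lambda\in M(E)\}\subset B$. It is natural if the associated map $\beta:X\times M(E)\to M(\tilde B)$, $\beta(x,\psi)=\psi\circ e_x$, is bijective. *)

(* Defs.v *)
From HB Require Import structures.
From mathcomp Require Import all_boot all_order all_algebra.
From mathcomp Require Import complex.
From mathcomp Require Import mathcomp_extra boolp classical_sets functions.
From mathcomp Require Import reals topology normedtype.

Set Implicit Arguments.
Unset Strict Implicit.
Unset Printing Implicit Defensive.

Import Order.TTheory GRing.Theory Num.Theory.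
Import numFieldNormedType.Exports.

Local Open Scope classical_set_scope.
Local Open Scope ring_scope.
Local Open Scope complex_scope.

(** * Commutative Banach algebras and their characters *)

Record is_norm (R : realType) (V : lmodType R[i]) (N : V -> R) : Prop := IsNorm {
  is_normD : forall a b, N (a + b) <= N a + N b;
  is_normZ : forall (k : R[i]) a, N (k *: a) = Normc.normc k * N a;
  is_norm0_eq0 : forall a, N a = 0 -> a = 0 }.

(* A commutative unital complex algebra with a norm of the underlying vector
   space; submultiplicativity is only required in [comBanachAlg]. A plain record
   is used because the structures comAlgType and normedModType have no
   join. Note that comAlgType imposes 1 != 0. *)
Record normedComAlg (R : realType) := NormedComAlg {
  nca_alg : comAlgType R[i];
  nca_norm : nca_alg -> R;
  nca_normP : is_norm nca_norm }.

Definition nca_car (R : realType) (A : normedComAlg R) : Type := nca_alg A.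
Coercion nca_car : normedComAlg >-> Sortclass.

Section NormedComAlgInstances.
Variables (R : realType) (A : normedComAlg R).

HB.instance Definition _ := GRing.ComAlgebra.copy (nca_car A) (nca_alg A).

Let N (a : nca_car A) : R[i] := (nca_norm a)%:C.

Let ND a b : N (a + b) <= N a + N b.
Proof. by rewrite /N -rmorphD lecR; exact: is_normD (nca_normP A) a b. Qed.

Let NZ (k : R[i]) a : N (k *: a) = `|k| * N a.
Proof.
rewrite /N [`|k|](erefl : `|k| = (Normc.normc k)%:C) -rmorphM; congr (_%:C).
exact: is_normZ (nca_normP A) k a.
Qed.

Let N0_eq0 a : N a = 0 -> a = 0.
Proof. by move=> /complexI; exact: is_norm0_eq0 (nca_normP A) a. Qed.

HB.instance Definition _ :=
  Lmodule_isNormed.Build R[i] (nca_car A) ND NZ N0_eq0.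

End NormedComAlgInstances.

Definition complete_norm (R : realType) (A : normedComAlg R) : Prop :=
  forall F : set_system A, ProperFilter F -> cauchy F -> cvg F.

Record comBanachAlg (R : realType) := ComBanachAlg {
  cba_nca :> normedComAlg R;
  cba_normM : forall a b : cba_nca,
    nca_norm (a * b) <= nca_norm a * nca_norm b;
  cba_complete : complete_norm cba_nca }.

Section Characters.
Variables (R : realType) (A : normedComAlg R).

Definition is_character (phi : A -> R[i]^o) : Prop :=
  [/\ linear phi, (forall a b, phi (a * b) = phi a * phi b)
    & exists a, phi a != 0].

(* M(A); as a subtype of {ptws A -> C} it carries the topology of pointwise
   convergence, which is the relative weak-star topology. *)
Definition characters : set {ptws A -> R[i]^o} := [set phi | is_character phi].

Definition gelfand (a : A) (phi : characters) : R[i]^o := \val phi a.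

Definition semisimple : Prop := injective gelfand.

Definition supp (a : A) : set characters :=
  closure [set chi | gelfand a chi != 0].

Definition Jideal (phi : characters) : set A := [set a | ~ supp a phi].

Definition bounded_relative_units : Prop :=
  forall phi : characters, exists2 m : R, 0 < m &
    forall K : set characters, compact K -> K `<=` [set~ phi] ->
      exists a : A, [/\ Jideal phi a, gelfand a @` K `<=` [set 1]
                      & nca_norm a <= m].

End Characters.

Arguments characters {R} A.
Arguments semisimple {R} A.
Arguments bounded_relative_units {R} A.

(** * Vector-valued function algebras *)

(* X is pointed only to make it nonempty, so that C(X, E) is a nontrivial
   algebra. *)
Record subalgebra (R : realType) (X : ptopologicalType) (E : normedComAlg R) :=
  Subalgebra {
  sub_set : set (X -> E);
  sub_continuous : forall f, sub_set f -> continuous f;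
  sub_cst1 : sub_set (cst 1);
  sub_linear : forall (k : R[i]) f g,
    sub_set f -> sub_set g -> sub_set (k *: f + g);
  sub_mul : forall f g, sub_set f -> sub_set g -> sub_set (f * g) }.

Definition sub_car (R : realType) (X : ptopologicalType) (E : normedComAlg R)
  (S : subalgebra X E) : Type := set_type (sub_set S).

Section SubalgebraInstances.
Variables (R : realType) (X : ptopologicalType) (E : normedComAlg R).
Variable S : subalgebra X E.

HB.instance Definition _ := SubChoice.copy (sub_car S) (set_type (sub_set S)).

Let S0 : 0 \in sub_set S.
Proof.
rewrite inE; have := sub_linear (-1) (sub_cst1 S) (sub_cst1 S).
by rewrite scaleN1r addNr.
Qed.

Let Sring : subring_closed (mem (sub_set S)).
Proof.
split=> [|f g|f g]; rewrite ?inE => *; first exact: sub_cst1.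
- by rewrite addrC -scaleN1r; exact: sub_linear.
- exact: sub_mul.
Qed.

Let Slin : subsemimod_closed (mem (sub_set S)).
Proof.
split=> [|k f]; last first.
  rewrite !inE => Sf; rewrite -[_ *: _]addr0; apply: sub_linear => //.
  by have := S0; rewrite inE.
split=> [|f g]; first exact: S0.
by rewrite !inE => Sf Sg; rewrite -[f]scale1r; exact: sub_linear.
Qed.

HB.instance Definition _ := GRing.SubChoice_isSubComNzRing.Build
  (X -> E) (mem (sub_set S)) (sub_car S) Sring.
HB.instance Definition _ := GRing.SubZmodule_isSubLmodule.Build
  R[i] (X -> E) (mem (sub_set S)) (sub_car S) Slin.

Let scalerAl (k : R[i]) (f g : sub_car S) : k *: (f * g) = k *: f * g.
Proof. by apply/val_inj/funext => x /=; exact: scalerAl. Qed.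

HB.instance Definition _ :=
  GRing.Lmodule_isLalgebra.Build R[i] (sub_car S) scalerAl.
HB.instance Definition _ :=
  GRing.Lalgebra_isComAlgebra.Build R[i] (sub_car S).

End SubalgebraInstances.

Record normed_subalgebra (R : realType) (X : ptopologicalType)
    (E : normedComAlg R) := NormedSubalgebra {
  ns_sub :> subalgebra X E;
  ns_norm : sub_car ns_sub -> R;
  ns_normP : is_norm ns_norm }.

Definition ns_nca (R : realType) (X : ptopologicalType) (E : normedComAlg R)
    (A : normed_subalgebra X E) : normedComAlg R :=
  @NormedComAlg R (sub_car A) (@ns_norm _ _ _ A) (ns_normP A).
Coercion ns_nca : normed_subalgebra >-> normedComAlg.

Section FunctionAlgebras.
Variables (R : realType) (X : ptopologicalType).

Definition pt_eval (E : normedComAlg R) (A : normed_subalgebra X E) (x : X)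
  (f : A) : E := \val (f : sub_car A) x.

(* The norm is any complete norm. When E is a Banach algebra, continuity of the
   evaluations makes the product of A jointly continuous (closed graph theorem),
   so that A is a Banach algebra up to an equivalent norm. Condition (1),
   that A contains the constant function 1, is [sub_cst1]. *)
Record function_algebra (E : normedComAlg R) := FunctionAlgebra {
  fa_ns :> normed_subalgebra X E;
  fa_complete : complete_norm fa_ns;
  fa_separates : forall x y, x <> y ->
    exists f : fa_ns, pt_eval x f <> pt_eval y f;
  fa_eval_continuous : forall x, continuous (pt_eval x : fa_ns -> E) }.

Fact normc_is_norm : is_norm (@Normc.normc R : R[i]^o -> R).
Proof.
split; [exact: le_normcD | exact: Normc.normcM
      | exact: Normc.eq0_normc].
Qed.

Definition complex_nca : normedComAlg R := NormedComAlg normc_is_norm.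

Definition natural_algebra (B : function_algebra complex_nca) : Prop :=
  forall phi : characters B, exists x, forall g : B, gelfand g phi = pt_eval x g.

Record admissible (E : comBanachAlg R) (B : function_algebra complex_nca)
    (Bt : function_algebra E) : Prop := Admissible {
  adm_compact : compact [set: X];
  adm_hausdorff : hausdorff_space X;
  adm_natural : natural_algebra B;
  adm_scale : forall (g : B) (a : E),
    sub_set Bt (fun x => (pt_eval x g : R[i]) *: a);
  adm_comp : forall (f : Bt) (psi : characters E),
    sub_set B (fun x => gelfand (pt_eval x f) psi) }.

Fact beta_subproof (E : normedComAlg R) (A : function_algebra E)
    (p : X * characters E) :
  (fun f : A => gelfand (pt_eval p.1 f) p.2 : R[i]^o) \in characters A.
Proof.
case: p => x psi; rewrite inE /=.
have [psil psiM [a psia]] := set_mem (valP psi).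
split=> [k f g|f g|]; first exact: psil.
- exact: psiM.
- exists 1; apply: contra psia => /eqP psi1.
  rewrite -[a]mulr1 psiM.
  by rewrite [X in _ * X](psi1 : (\val psi : _ -> _) 1 = 0) mulr0.
Qed.

(* beta (x, psi) = psi \o e_x *)
Definition beta (E : normedComAlg R) (A : function_algebra E)
    (p : X * characters E) : characters A :=
  SigSub (beta_subproof A p).

Definition natural_quadruple (E : comBanachAlg R)
    (B : function_algebra complex_nca) (Bt : function_algebra E) : Prop :=
  admissible B Bt /\ bijective (@beta E Bt).

End FunctionAlgebras.

Arguments complex_nca {R}.

(* Main.v *)
Require Import Defs.
From mathcomp Require Import all_boot all_order all_algebra.
From mathcomp Require Import complex.
From mathcomp Require Import boolp classical_sets functions.
From mathcomp Require Import reals topology normedtype sequences.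
From mathcomp Require Import ring lra.

(* Every bound comes from a closed graph theorem that is uniform over a
   pointwise bounded family of operators; it applies to operators into a
   function algebra whose composites with the evaluations are bounded. It bounds
   the slices f |-> psi \o f from Bt to B and the bilinear map (g, a) |-> g . a
   from B x E to Bt. The transposes of e_x and of the slices embed M(E) and M(B)
   into M(Bt), so relative units of Bt push forward to E and to B. Conversely,
   restricting characters of Bt to B . 1 and 1 . E embeds M(Bt) into
   M(B) x M(E); if g and a are relative units of B at x and of E at psi, then
   1 - (1 - g)(1 - a) is one of Bt at beta (x, psi). Compactness of the
   character spaces plays no role: the sets K are projected to M(B) and M(E). *)
Set Implicit Arguments.
Unset Strict Implicit.
Unset Printing Implicit Defensive.

Import Order.TTheory GRing.Theory Num.Theory.
Import numFieldNormedType.Exports.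

Local Open Scope classical_set_scope.
Local Open Scope ring_scope.
Local Open Scope complex_scope.

(** * Real-valued norms, and completeness for sequences with a rate *)

Section NcaNorm.
Variables (R : realType) (A : normedComAlg R).
Implicit Types (a b : A) (k : R[i]).

Lemma nca_normE a : `|a| = (nca_norm a)%:C.
Proof. by []. Qed.

Lemma nca_normD a b : nca_norm (a + b) <= nca_norm a + nca_norm b.
Proof. exact: is_normD (nca_normP A) a b. Qed.

Lemma nca_normZ k a : nca_norm (k *: a) = Normc.normc k * nca_norm a.
Proof. exact: is_normZ (nca_normP A) k a. Qed.

Lemma nca_norm_ge0 a : 0 <= nca_norm a.
Proof. by rewrite -lecR -nca_normE normr_ge0. Qed.

Lemma nca_norm0 : nca_norm (0 : A) = 0.
Proof. by apply: complexI; rewrite -nca_normE normr0. Qed.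

Lemma nca_norm_eq0 a : nca_norm a = 0 -> a = 0.
Proof. exact: is_norm0_eq0 (nca_normP A) a. Qed.

Lemma nca_norm_gt0 a : (0 < nca_norm a) = (a != 0).
Proof. by rewrite -ltcR -nca_normE normr_gt0. Qed.

Lemma nca_normN a : nca_norm (- a) = nca_norm a.
Proof. by apply: complexI; rewrite -!nca_normE normrN. Qed.

Lemma nca_distC a b : nca_norm (a - b) = nca_norm (b - a).
Proof. by rewrite -nca_normN opprB. Qed.

Lemma nca_distD b a c : nca_norm (a - c) <= nca_norm (a - b) + nca_norm (b - c).
Proof. by rewrite -[a - c](subrKA b) nca_normD. Qed.

Lemma nca_normrZ (t : R) a : 0 <= t -> nca_norm (t%:C *: a) = t * nca_norm a.
Proof.
move=> t0; rewrite nca_normZ; congr (_ * _).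
by rewrite /= expr0n addr0 sqrtr_sqr ger0_norm.
Qed.

(** The tails form a Cauchy filter, and letting [m] tend to infinity keeps the rate. Having the
    error [r n] at every index, [n = 0] included, is what the successive approximations below rely
    on. *)
Lemma complete_seq (hA : complete_norm A) (u : nat -> A) (r : nat -> R) :
    (forall n m, (n <= m)%N -> nca_norm (u m - u n) <= r n) ->
    r @ \oo --> (0 : R) ->
  exists l, forall n, nca_norm (u n - l) <= r n.
Proof.
move=> ur r0.
have rlt (e : R) : 0 < e -> exists n, r n < e.
  move=> e0; have /cvgrPdist_lt /(_ e e0) [n _ /(_ n (leqnn n))] := r0.
  by rewrite sub0r normrN /= => /(le_lt_trans (ler_norm _)); exists n.
have /hA /cvg_ex[l ul] : cauchy (u @ \oo).
  apply: cauchy_exP => e e0.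
  (* A positive element of [R[i]] is real, so [e] comes from a real radius. *)
  have eE : (complex.Re e)%:C = e by rewrite RRe_real// gtr0_real.
  have [|n rn] := rlt (complex.Re e); first by rewrite -ltcR eE.
  exists (u n), n => // m /= nm.
  rewrite -ball_normE /ball_ /= nca_normE -eE ltcR nca_distC.
  exact: le_lt_trans (ur _ _ nm) rn.
exists l => n; apply/ler_addgt0Pr => e e0.
move: ul => /cvgrPdist_lt /(_ e%:C); rewrite ltcR => /(_ e0)[k _].
move=> /(_ _ (leq_maxl k n)) /=; rewrite nca_normE ltcR => /ltW ke.
rewrite (le_trans (nca_distD (u (maxn k n)) _ _))// nca_distC.
by rewrite lerD ?ur ?leq_maxr// nca_distC.
Qed.
End NcaNorm.

(** * Baire category and the uniform closed graph theorem *)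

Lemma cvg_half_geometric (R : realType) (c : R) :
  geometric c 2^-1 @ \oo --> (0 : R).
Proof.
apply: cvg_geometric.
by rewrite gtr0_norm ?invr_gt0 ?invf_lt1 ?ltr1n ?ltr0n.
Qed.

Section ClosedGraph.
Variables (R : realType) (V W : normedComAlg R).
Hypotheses (Vcomplete : complete_norm V) (Wcomplete : complete_norm W).

(** Baire's theorem, with density in a closed ball spelled out in norms. If every [F n] failed it,
    one could choose nested closed balls, with radii at least halved and each step avoiding the next
    [F n]; their centres would converge to a point in no [F n]. *)
Lemma baire_ball (F : nat -> set V) : (forall v, exists n, F n v) ->
  exists n c r, 0 < r /\ forall v e, nca_norm (v - c) <= r -> 0 < e ->
    exists2 a, F n a & nca_norm (v - a) < e.
Proof.
move=> Fcover; apply: contrapT => nF.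
(* [x] holds an index, a centre and a radius. Positivity of the radius is a premise under the
   existential, so that [choice] yields a total function. *)
have step (x : nat * (V * R)) : exists y : V * R, 0 < x.2.2 ->
    [/\ 0 < y.2, y.2 <= x.2.2 / 2, nca_norm (y.1 - x.2.1) + y.2 <= x.2.2
      & forall w, nca_norm (y.1 - w) <= y.2 -> ~ F x.1 w].
  case: x => n [c r] /=; have [r0|] := ltP 0 r; last by exists (c, r).
  apply: contrapT => nstep; apply: nF; exists n, c, (r / 2).
  split=> [|v e vr e0]; first lra.
  apply: contrapT => nFe; apply: nstep; exists (v, Num.min (r / 2) (e / 2)).
  move=> _ /=; have [d1 d2] : Num.min (r / 2) (e / 2) <= r / 2 /\
    Num.min (r / 2) (e / 2) <= e / 2 by rewrite !ge_min !lexx orbT.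
  split=> //; first by rewrite lt_min !divr_gt0.
    lra.
  by move=> w vw Fw; apply: nFe; exists w => //; lra.
have [f fP] := choice step.
pose s := fix s n := if n is m.+1 then f (m, s m) else (0 : V, 1 : R).
have s0 n : 0 < (s n).2.
  by elim: n => [|n /(fP (n, s n))[]]; rewrite ?ltr01.
have sle n : (s n).2 <= 1 * 2^-1 ^+ n.
  elim: n => [|n IHn]; first by rewrite expr0 mulr1.
  have [_ + _ _] := fP (n, s n) (s0 n); rewrite /= exprS.
  by move/le_trans; apply; rewrite mulrC mulrCA ler_pM2l// invr_gt0 ltr0n.
have sdist n m : (n <= m)%N ->
    nca_norm ((s m).1 - (s n).1) + (s m).2 <= (s n).2.
  move=> /subnKC <-; elim: (m - n)%N => [|k IHk].
    by rewrite addn0 subrr nca_norm0 add0r.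
  have [_ _ h _] := fP ((n + k)%N, s (n + k)%N) (s0 _).
  rewrite addnS; rewrite /= in h *.
  have := nca_distD (s (n + k)%N).1 (f ((n + k)%N, s (n + k)%N)).1 (s n).1.
  lra.
have [n m nm||l ls] := complete_seq (u := fst \o s) (r := snd \o s) Vcomplete.
- by apply: le_trans (sdist _ _ nm); rewrite lerDl ltW.
- apply: (squeeze_cvgr _ (@cvg_cst _ _ _ _ _) (cvg_half_geometric 1)).
  by near=> n; rewrite (ltW (s0 n)) sle.
have [n Fnl] := Fcover l.
(* [l] lies in every ball of the sequence, and the ball of index [n.+1] avoids [F n]. *)
by have [_ _ _ /(_ l (ls n.+1))] := fP (n, s n) (s0 n).
Unshelve. all: by end_near. Qed.

(** With [I] a single point this is the closed graph theorem. In general the sets where all [T i]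
    are bounded by [n] cover [V], so one ball serves the whole family, and successive approximation,
    as for the open mapping theorem, gives a constant independent of [i]. *)
Theorem uniform_closed_graph (I : Type) (T : I -> V -> W) :
    (forall i, linear (T i)) ->
    (forall i (u : nat -> V) (v : V) (w : W),
       (fun n => nca_norm (u n - v)) @ \oo --> (0 : R) ->
       (fun n => nca_norm (T i (u n) - w)) @ \oo --> (0 : R) -> T i v = w) ->
    (forall v, exists M, forall i, nca_norm (T i v) <= M) ->
  exists2 C, 0 <= C & forall i v, nca_norm (T i v) <= C * nca_norm v.
Proof.
move=> Tlin Tgraph Tbd.
have TD i u v : T i (u + v) = T i u + T i v.
  by have := Tlin i 1 u v; rewrite !scale1r.
have T0 i : T i 0 = 0 by apply: (addrI (T i 0)); rewrite -TD !addr0.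
have TZ i k v : T i (k *: v) = k *: T i v.
  by have := Tlin i k v 0; rewrite T0 !addr0.
have TB i u v : T i (u - v) = T i u - T i v by rewrite TD -scaleN1r TZ scaleN1r.
pose F n : set V := [set v | forall i, nca_norm (T i v) <= n%:R].
have [v|n [c [r [r_gt0 nF]]]] := @baire_ball F.
  have [M TM] := Tbd v; exists (Num.truncn M).+1 => i.
  by rewrite (le_trans (TM i))// ltW// truncnS_gt.
pose C : R := (2 * n)%:R.
(* By Baire, F n is dense in some ball; differences of its points are then dense
   in a ball around 0, which starts the successive approximation below. *)
have approx1 v : nca_norm v <= r -> exists2 a, (forall i, nca_norm (T i a) <= C)
    & nca_norm (v - a) <= r / 2.
  move=> vr; have [||a Fa va] := nF (v + c) (r / 4).
  - by rewrite addrK.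
  - lra.
  have [||b Fb cb] := nF c (r / 4).
  - by rewrite subrr nca_norm0 ltW.
  - lra.
  exists (a - b) => [i|].
    rewrite TB (le_trans (nca_normD _ _))// nca_normN.
    by rewrite /C mul2n -addnn natrD lerD.
  have -> : v - (a - b) = (v + c - a) - (c - b).
    by rewrite opprB [RHS]addrC opprB; ring.
  rewrite (le_trans (nca_normD _ _))// nca_normN; lra.
(* The same approximation at scale [2^-1 ^+ k], by homogeneity. *)
have approx k v : exists a, nca_norm v <= r * 2^-1 ^+ k ->
    (forall i, nca_norm (T i a) <= C * 2^-1 ^+ k) /\
    nca_norm (v - a) <= r * 2^-1 ^+ k.+1.
  have [vr|] := leP (nca_norm v) (r * 2^-1 ^+ k); last by exists 0.
  have k0 : 0 < 2 ^+ k :> R by rewrite exprn_gt0.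
  have [|a Ta va] := approx1 ((2 ^+ k)%:C *: v).
    by rewrite nca_normrZ ?(ltW k0)// mulrC -ler_pdivlMr// -exprVn.
  have kE u : ((2 ^+ k)^-1)%:C *: ((2 ^+ k)%:C *: u) = u :> V.
    by rewrite scalerA -rmorphM mulVf ?scale1r// gt_eqF.
  exists (((2 ^+ k)^-1)%:C *: a) => _; split=> [i|].
    rewrite TZ nca_normrZ ?invr_ge0 ?(ltW k0)// exprVn mulrC.
    by rewrite ler_pM2r ?invr_gt0.
  rewrite -[v]kE -scalerBr nca_normrZ ?invr_ge0 ?(ltW k0)//.
  by rewrite exprSr exprVn mulrC mulrA (mulrAC r) ler_pM2r ?invr_gt0.
have [f fP] := choice (fun x => approx x.1 x.2).
have unit_bound i v : nca_norm v <= r -> nca_norm (T i v) <= C * 2.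
  move=> vr.
  (* [s k] is what remains of [v] after [k] corrections. The partial sums [v - s k] tend to [v] and
     their images form a Cauchy sequence, so closedness of the graph identifies the limit with
     [T i v]. *)
  pose s := fix s k := if k is j.+1 then s j - f (j, s j) else v.
  have sr k : nca_norm (s k) <= r * 2^-1 ^+ k.
    elim: k => [|k IHk]; first by rewrite expr0 mulr1.
    by have [] := fP (k, s k) IHk.
  have Ts m k : (m <= k)%N -> nca_norm (T i (v - s k) - T i (v - s m)) <=
      C * 2 * 2^-1 ^+ m - C * 2 * 2^-1 ^+ k.
    move=> /subnKC <-; elim: (k - m)%N => [|j IHj].
      by rewrite addn0 !subrr nca_norm0.
    have [/(_ i) Tf _] := fP ((m + j)%N, s (m + j)%N) (sr _).
    rewrite addnS (le_trans (nca_distD (T i (v - s (m + j)%N)) _ _))//.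
    rewrite -[X in nca_norm X + _]TB /=.
    rewrite (_ : _ - _ - _ = f ((m + j)%N, s (m + j)%N)); last by ring.
    rewrite exprS /= in Tf *; lra.
  have Crate : geometric (C * 2) 2^-1 @ \oo --> (0 : R).
    exact: cvg_half_geometric.
  have [m k mk|w Tw] :=
    complete_seq (u := fun m => T i (v - s m)) Wcomplete _ Crate.
    rewrite (le_trans (Ts _ _ mk))// gerDl oppr_le0.
    by rewrite mulr_ge0 ?exprn_ge0 ?invr_ge0// mulr_ge0 ?ler0n.
  have : T i v = w.
    apply: (Tgraph i (fun m => v - s m)).
      apply: (squeeze_cvgr _ (@cvg_cst _ _ _ _ _) (cvg_half_geometric r)).
      apply: nearW => m; rewrite nca_norm_ge0 /= addrAC subrr sub0r nca_normN.
      exact: sr.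
    apply: (squeeze_cvgr _ (@cvg_cst _ _ _ _ _) Crate).
    by apply: nearW => m; rewrite nca_norm_ge0 Tw.
  (* The partial sum of index 0 vanishes, so its error estimate bounds [w] itself. *)
  move=> ->; have := Tw 0%N.
  by rewrite /= subrr T0 sub0r nca_normN expr0 mulr1.
exists (C * 2 / r) => [|i v]; first by rewrite divr_ge0 ?(ltW r_gt0)// mulr_ge0.
have [->|v0] := eqVneq v 0; first by rewrite T0 !nca_norm0 mulr0.
have {}v0 : 0 < nca_norm v by rewrite nca_norm_gt0.
have /(unit_bound i) : nca_norm ((r / nca_norm v)%:C *: v) <= r.
  by rewrite nca_normrZ ?divr_ge0 ?nca_norm_ge0 ?(ltW r_gt0)// divfK// gt_eqF.
rewrite TZ nca_normrZ ?divr_ge0 ?nca_norm_ge0 ?(ltW r_gt0)//.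
by rewrite mulrAC ler_pdivrMr// mulrC -ler_pdivlMr// mulrAC.
Qed.
End ClosedGraph.

(** * The Gelfand transform and the topology of the character space *)

Section Characters.
Variables (R : realType) (A : normedComAlg R).
Implicit Types (a : A) (phi : characters A).

Lemma gelfandD a b phi : gelfand (a + b) phi = gelfand a phi + gelfand b phi.
Proof.
have [philin _ _] := set_mem (valP phi).
by have := philin 1 a b; rewrite !scale1r.
Qed.

Lemma gelfandM a b phi : gelfand (a * b) phi = gelfand a phi * gelfand b phi.
Proof. by have [_ phiM _] := set_mem (valP phi); exact: phiM. Qed.

Lemma gelfand1 phi : gelfand 1 phi = 1.
Proof.
have [_ _ [a phia]] := set_mem (valP phi).
by apply: (mulfI phia); rewrite -gelfandM !mulr1.
Qed.

Lemma gelfand0 phi : gelfand 0 phi = 0.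
Proof. by apply: (addrI (gelfand 0 phi)); rewrite -gelfandD !addr0. Qed.

Lemma gelfandZ k a phi : gelfand (k *: a) phi = k * gelfand a phi.
Proof.
have [philin _ _] := set_mem (valP phi).
have phi0 : \val phi 0 = 0 := gelfand0 phi.
by have := philin k a 0; rewrite phi0 !addr0.
Qed.

Lemma gelfandN a phi : gelfand (- a) phi = - gelfand a phi.
Proof. by rewrite -scaleN1r gelfandZ mulN1r. Qed.

Lemma character_ext phi chi :
  (forall a, gelfand a phi = gelfand a chi) -> phi = chi.
Proof. by move=> e; apply/val_inj/funext. Qed.

Lemma gelfand_continuous a : continuous (gelfand a).
Proof.
move=> phi; apply: (@continuous_comp _ _ _
  (\val : characters A -> {ptws A -> R[i]^o}) (fun f => f a)).
  exact: (initial_continuous (f := \val : characters A -> {ptws A -> R[i]^o})).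
exact: (@proj_continuous _ (fun=> R[i]^o) a).
Qed.

Lemma continuous_to_characters (Y : topologicalType) (h : Y -> characters A) :
  (forall a, continuous (gelfand a \o h)) -> continuous h.
Proof.
move=> hc; apply: continuous_comp_initial => y; apply/pointwise_cvgP => a.
exact: hc.
Qed.

Lemma characters_hausdorff : hausdorff_space (characters A).
Proof.
move=> phi chi clus; apply: character_ext => a.
apply: (@norm_hausdorff _ R[i]^o) => U V phiU chiV.
have [xi [/= Uxi Vxi]] :=
  clus _ _ (gelfand_continuous phiU) (gelfand_continuous chiV).
by exists (gelfand a xi).
Qed.

(** Vanishing near [phi] is the form that pulls back along continuous maps of character spaces. *)
Lemma JidealP phi a : Jideal phi a <-> \forall chi \near phi, gelfand a chi = 0.
Proof.
split=> [nsupp|near0 /(_ _ near0)[chi []]]; last by move=> /= /eqP.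
apply: contrapT => nnear; apply: nsupp => U Uphi; apply: contrapT => U0.
apply: nnear; apply: filterS Uphi => chi Uchi; apply: contrapT => /eqP chia.
by apply: U0; exists chi.
Qed.

End Characters.

(** * Unital homomorphisms and their transposes on characters *)

Record unital_hom (R : realType) (A A' : normedComAlg R) (T : A -> A') : Prop :=
  UnitalHom {
  uhom_linear : linear T;
  uhom_mul : {morph T : a b / a * b};
  uhom_1 : T 1 = 1 }.

Fact comap_subproof (R : realType) (A A' : normedComAlg R) (T : A -> A')
    (Thom : unital_hom T) (chi : characters A') :
  (fun a => gelfand (T a) chi : R[i]^o) \in characters A.
Proof.
rewrite inE /=; split=> [k a b|a b|].
- by rewrite (uhom_linear Thom) gelfandD gelfandZ.
- by rewrite (uhom_mul Thom) gelfandM.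
- by exists 1; rewrite (uhom_1 Thom) gelfand1 oner_neq0.
Qed.

Definition comap (R : realType) (A A' : normedComAlg R) (T : A -> A')
    (Thom : unital_hom T) (chi : characters A') : characters A :=
  SigSub (comap_subproof Thom chi).

Lemma gelfand_comap (R : realType) (A A' : normedComAlg R) (T : A -> A')
    (Thom : unital_hom T) (a : A) (chi : characters A') :
  gelfand a (comap Thom chi) = gelfand (T a) chi.
Proof. by []. Qed.

Lemma comap_continuous (R : realType) (A A' : normedComAlg R) (T : A -> A')
  (Thom : unital_hom T) : continuous (comap Thom).
Proof. by apply: continuous_to_characters => a; exact: gelfand_continuous. Qed.

Lemma hausdorff_pair (T U : topologicalType) :
  hausdorff_space T -> hausdorff_space U -> hausdorff_space (T * U)%type.
Proof.
move=> hT hU [t u] [t' u'] clus; congr (_, _).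
- apply: hT => P Q tP tQ.
  have [[a b] [/= Pa Qa]] := clus _ _ (cvg_fst tP) (cvg_fst tQ).
  by exists a.
- apply: hU => P Q uP uQ.
  have [[a b] [/= Pb Qb]] := clus _ _ (cvg_snd uP) (cvg_snd uQ).
  by exists b.
Qed.

(** * Transfer of bounded relative units *)

Section Transfer.
Variable R : realType.

(** Take a relative unit of [A] at the image of [phi] for the image of [K], and apply [T].
    Injectivity of the transpose keeps the image of [phi] outside the image of [K]. *)
Lemma bounded_relative_units_comap (A A' : normedComAlg R) (T : A -> A')
    (Thom : unital_hom T) (C : R) :
    0 <= C -> (forall a, nca_norm (T a) <= C * nca_norm a) ->
    injective (comap Thom) ->
  bounded_relative_units A -> bounded_relative_units A'.
Proof.
move=> C_ge0 TC Tinj bruA phi; have [m m0 mP] := bruA (comap Thom phi).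
(* [C] may be 0, while the bound has to be positive. *)
exists ((C + 1) * m); first by rewrite mulr_gt0// ltr_wpDl.
move=> K Kcpt Kphi; have [||a [Ja aK am]] := mP (comap Thom @` K).
- apply: continuous_compact Kcpt; apply: continuous_subspaceT.
  exact: comap_continuous.
- by move=> _ [chi Kchi <-] /Tinj chiphi; exact: Kphi chiphi.
exists (T a); split.
- move/JidealP in Ja; apply/JidealP.
  exact: (@comap_continuous _ _ _ _ Thom phi _ Ja).
- move=> _ [chi Kchi <-]; rewrite -gelfand_comap.
  by apply: aK; do 2 eexists=> //.
- by rewrite (le_trans (TC _))// ler_pM ?nca_norm_ge0// lerDl.
Qed.

(** The identity in the hypothesis makes [a] play the role of 1 - (1 - a1)(1 - a2): it is 1 where
    either factor is 1 and 0 where both are 0. Hence each point of [K] has to be separated from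
    [phi] by only one of [h1] and [h2]. *)
Lemma bounded_relative_units_join (A A1 A2 : normedComAlg R)
    (h1 : characters A -> characters A1) (h2 : characters A -> characters A2) :
    continuous h1 -> continuous h2 ->
    injective (fun chi => (h1 chi, h2 chi)) ->
    (forall m1 m2, exists m, forall a1 a2,
      nca_norm a1 <= m1 -> nca_norm a2 <= m2 -> exists2 a : A,
        forall chi, 1 - gelfand a chi =
          (1 - gelfand a1 (h1 chi)) * (1 - gelfand a2 (h2 chi))
        & nca_norm a <= m) ->
  bounded_relative_units A1 -> bounded_relative_units A2 ->
  bounded_relative_units A.
Proof.
move=> h1c h2c hinj join bru1 bru2 phi.
have [m1 m1_gt0 m1P] := bru1 (h1 phi).
have [m2 m2_gt0 m2P] := bru2 (h2 phi).
have [m mP] := join m1 m2.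
exists (Num.max m 1) => [|K Kcpt Kphi]; first by rewrite lt_max ltr01 orbT.
pose h chi := (h1 chi, h2 chi).
have hc : continuous h by move=> chi; exact: (cvg_pair (h1c chi) (h2c chi)).
have [K1cpt K2cpt] : compact (h1 @` K) /\ compact (h2 @` K).
  by split; apply: continuous_compact Kcpt; exact: continuous_subspaceT.
have hKcl : closed (h @` K).
  apply: compact_closed; last first.
    by apply: continuous_compact Kcpt; exact: continuous_subspaceT.
  by apply: hausdorff_pair; exact: characters_hausdorff.
have [[U V] /= [Uphi Vphi] UV] : nbhs (h phi) (~` (h @` K)).
  apply: open_nbhs_nbhs; split; first exact: closed_openC.
  by move=> [chi Kchi /hinj chiphi]; exact: Kphi chiphi.
(* Removing the interior of [U] from the projection of [K] leaves a compact set that misses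
   [h1 phi]. *)
have [||a1 [Ja1 a1K a1m]] := m1P ((h1 @` K) `&` ~` U°).
- by apply: compact_closedI => //; apply: open_closedC; exact: open_interior.
- by move=> x [_ nU] xphi; apply: nU; rewrite xphi.
have [||a2 [Ja2 a2K a2m]] := m2P ((h2 @` K) `&` ~` V°).
- by apply: compact_closedI => //; apply: open_closedC; exact: open_interior.
- by move=> x [_ nV] xphi; apply: nV; rewrite xphi.
have [a aP am] := mP a1 a2 a1m a2m; exists a; split.
- move/JidealP in Ja1; move/JidealP in Ja2; apply/JidealP.
  have near1 : \forall chi \near phi, gelfand a1 (h1 chi) = 0 := h1c phi _ Ja1.
  have near2 : \forall chi \near phi, gelfand a2 (h2 chi) = 0 := h2c phi _ Ja2.
  near=> chi; have := aP chi.
  rewrite (near near1)// (near near2)// !subr0 mulr1.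
  by move/eqP; rewrite subr_eq addrC -subr_eq subrr => /eqP.
- move=> _ [chi Kchi <-] /=; apply/eqP; rewrite -subr_eq0 -oppr_eq0 opprB aP.
  rewrite mulf_eq0 !subr_eq0.
  have [Uchi|nU] := pselect (U° (h1 chi)); last first.
    rewrite [gelfand a1 _]a1K ?eqxx//.
    by exists (h1 chi) => //; split=> //; exists chi.
  have [Vchi|nV] := pselect (V° (h2 chi)); last first.
    rewrite [gelfand a2 _]a2K ?eqxx ?orbT//.
    by exists (h2 chi) => //; split=> //; exists chi.
  exfalso; apply: (UV (h chi)); first by split; exact: interior_subset.
  by exists chi.
- by rewrite (le_trans am)// le_max lexx.
Unshelve. all: by end_near. Qed.
End Transfer.

(** * Bounds for continuous linear maps and for characters *)

Lemma nca_eq_lim0 (R : realType) (A : normedComAlg R) (a b : A) (f : nat -> R) :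
  (forall n, nca_norm (a - b) <= f n) -> f @ \oo --> (0 : R) -> a = b.
Proof.
move=> abf f0; apply/eqP; rewrite -subr_eq0; apply/eqP/nca_norm_eq0.
apply/eqP; rewrite eq_le nca_norm_ge0 andbT.
by apply: (cvgr_to_ge f0); exact: nearW.
Qed.

Lemma continuous_linear_bound (R : realType) (A A' : normedComAlg R)
    (T : A -> A') :
    linear T -> continuous T ->
  exists2 C, 0 <= C & forall a, nca_norm (T a) <= C * nca_norm a.
Proof.
move=> Tlin Tcont.
have T0 : T 0 = 0.
  by apply: (addrI (T 0)); have := Tlin 1 0 0; rewrite !scale1r !addr0.
have TZ k a : T (k *: a) = k *: T a by have := Tlin k a 0; rewrite T0 !addr0.
have /cvgrPdist_lt /(_ 1 ltr01) := Tcont 0.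
rewrite T0 => /nbhs_normP[d /= d_gt0 dP].
have dE : (complex.Re d)%:C = d by rewrite RRe_real// gtr0_real.
set e := complex.Re d in dE.
have e_gt0 : 0 < e by rewrite -ltcR dE.
(* [T] has norm below 1 on the open ball of radius [e]; vectors are scaled to norm [e / 2] to fall
   inside it. *)
exists (2 / e) => [|a]; first by rewrite divr_ge0 ?(ltW e_gt0).
have [->|a0] := eqVneq a 0; first by rewrite T0 !nca_norm0 mulr0.
have {}a0 : 0 < nca_norm a by rewrite nca_norm_gt0.
have s_ge0 : 0 <= e / 2 / nca_norm a.
  by rewrite !divr_ge0 ?(ltW e_gt0) ?nca_norm_ge0.
have := dP ((e / 2 / nca_norm a)%:C *: a).
rewrite /ball_ /= !sub0r !normrN TZ !nca_normE !nca_normrZ// -dE ltcR.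
rewrite divfK ?gt_eqF// ltr_pdivrMr// ltr_pMr// ltr1n => /(_ isT).
rewrite [X in _ < X](_ : _ = 1%:C)// ltcR => /ltW.
rewrite mulrAC ler_pdivrMr// mul1r mulrC -ler_pdivlMr ?divr_gt0//.
by rewrite invf_div mulrC.
Qed.

(** Composition with [psi] does not increase norms, which supplies the pointwise estimate for the
    slices. *)
Lemma character_bound (R : realType) (E : comBanachAlg R)
    (psi : characters E) (a : E) :
  Normc.normc (gelfand a psi) <= nca_norm a.
Proof.
rewrite leNgt; apply/negP => psia_gt.
have psia0 : gelfand a psi != 0.
  apply: contraTneq psia_gt => ->; rewrite Normc.normc0 -leNgt.
  exact: nca_norm_ge0.
have n_gt0 : 0 < Normc.normc (gelfand a psi).
  exact: le_lt_trans (nca_norm_ge0 _) psia_gt.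
(* ||b|| < 1 and psi b = 1, yet the sum l of the powers b ^+ k.+1 satisfies
   l = b + b * l. *)
pose b : E := (gelfand a psi)^-1 *: a.
have psib : gelfand b psi = 1 by rewrite gelfandZ mulVf.
set q := nca_norm b.
have q_ge0 : 0 <= q := nca_norm_ge0 b.
have q_lt1 : q < 1.
  by rewrite /q /b nca_normZ Normc.normcV mulrC ltr_pdivrMr// mul1r.
pose u n : E := \sum_(k < n) b ^+ k.+1.
have bX n : nca_norm (b ^+ n.+1) <= q ^+ n.
  elim: n => [|n IHn]; first by rewrite expr1 expr0 ltW.
  rewrite exprS [leRHS]exprS (le_trans (cba_normM _ _))//.
  by rewrite ler_wpM2l.
have udist n m : (n <= m)%N ->
    nca_norm (u m - u n) <= (q ^+ n - q ^+ m) / (1 - q).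
  move=> /subnKC <-; elim: (m - n)%N => [|k IHk].
    by rewrite addn0 !subrr nca_norm0 mul0r.
  rewrite addnS (le_trans (nca_distD (u (n + k)%N) _ _))//.
  rewrite /u big_ord_recr /= -/(u _) addrAC subrr add0r.
  rewrite (le_trans (lerD (bX _) IHk))//.
  rewrite le_eqVlt exprS; apply/orP; left; apply/eqP; field.
  by rewrite subr_eq0 gt_eqF.
pose r := geometric (1 - q)^-1 q.
have r_cvg0 : r @ \oo --> (0 : R) by apply: cvg_geometric; rewrite ger0_norm.
have q'_ge0 : 0 <= (1 - q)^-1 by rewrite invr_ge0 subr_ge0 ltW.
have [n m nm|l ul] := complete_seq (u := u) (@cba_complete _ E) _ r_cvg0.
  rewrite (le_trans (udist _ _ nm))// mulrC /= ler_wpM2l//.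
  by rewrite gerDl oppr_le0 exprn_ge0.
have lE : l = b + b * l.
  apply: (@nca_eq_lim0 _ _ _ _ (fun n => 2 * r n)); last first.
    by rewrite -[X in _ --> X](mulr0 2); apply: cvgMr.
  move=> n.
  have uS : u n.+1 = b + b * u n.
    by rewrite /u big_ord_recl expr1 /= mulr_sumr; congr (_ + _).
  rewrite (le_trans (nca_distD (u n.+1) _ _))// mulr_natl mulr2n lerD//.
    rewrite nca_distC (le_trans (ul _))//=.
    by rewrite ler_wpM2l// exprS ler_piMl ?exprn_ge0// ltW.
  rewrite (_ : u n.+1 - _ = b * (u n - l)); last by rewrite uS; ring.
  rewrite (le_trans (cba_normM _ _))//.
  by rewrite (le_trans _ (ul n))// ler_piMl ?nca_norm_ge0// ltW.
(* Applying [psi] to [lE] gives psi(l) = 1 + psi(l). *)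
have := gelfandD b (b * l) psi; rewrite -lE gelfandM psib mul1r.
move/(congr1 (fun x => x - gelfand l psi)); rewrite subrr addrK.
by move/eqP; rewrite eq_sym oner_eq0.
Qed.

(** * The closed graph theorem for maps into a function algebra *)

Section FunctionAlgebra.
Variables (R : realType) (X : ptopologicalType) (E : normedComAlg R).
Variable F : function_algebra X E.

Definition fa_elt (f : X -> E) (Ff : sub_set F f) : F := SigSub (mem_set Ff).

Lemma fa_ext (f g : F) : (forall x, pt_eval x f = pt_eval x g) -> f = g.
Proof. by move=> fg; apply/val_inj/funext. Qed.

Lemma pt_eval_unital_hom x : unital_hom (pt_eval x : F -> E).
Proof. by []. Qed.

(** The graphs are closed: if [u n] tends to [v] and [T i (u n)] to [w], then at each [x] the values
    of [T i (u n)] tend both to that of [T i v], by the bound on the composite, and to that of [w],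
    by continuity of evaluation. The constants assumed may depend on [i] and [x]. *)
Lemma fa_uniform_bound (V : normedComAlg R) (Vcomplete : complete_norm V)
    (I : Type) (T : I -> V -> F) :
    (forall i, linear (T i)) ->
    (forall i x, exists C, forall v,
       nca_norm (pt_eval x (T i v)) <= C * nca_norm v) ->
    (forall v, exists M, forall i, nca_norm (T i v) <= M) ->
  exists2 C, 0 <= C & forall i v, nca_norm (T i v) <= C * nca_norm v.
Proof.
move=> Tlin Teval Tbd; apply: uniform_closed_graph => //.
  exact: fa_complete.
move=> i u v w uv Tuw; apply: fa_ext => x.
have [C TC] := Teval i x.
have [D D_ge0 DP] := continuous_linear_bound
  (uhom_linear (pt_eval_unital_hom x)) (@fa_eval_continuous _ _ _ F x).
have eB f g : pt_eval x (f - g) = pt_eval x f - pt_eval x g by [].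
apply: (@nca_eq_lim0 _ _ _ _ (fun n =>
    C * nca_norm (u n - v) + D * nca_norm (T i (u n) - w))) => [n|]; last first.
  rewrite [X in _ --> X](_ : _ = C * 0 + D * 0); last by rewrite !mulr0 addr0.
  by apply: cvgD; apply: cvgMr.
rewrite (le_trans (nca_distD (pt_eval x (T i (u n))) _ _))// lerD// -?eB//.
have -> : T i v - T i (u n) = T i (v - u n).
  have := Tlin i (-1) (u n) v; rewrite !scaleN1r => TB.
  by rewrite [v - _]addrC TB addrC.
by rewrite (nca_distC (u n)).
Qed.

End FunctionAlgebra.

Lemma pt_eval_bounded (R : realType) (X : ptopologicalType) (E : normedComAlg R)
    (F : function_algebra X E) (x : X) :
  exists2 C, 0 <= C & forall f : F, nca_norm (pt_eval x f) <= C * nca_norm f.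
Proof.
apply: continuous_linear_bound (@fa_eval_continuous _ _ _ F x).
exact: uhom_linear (pt_eval_unital_hom F x).
Qed.

(** * Elementary tensors and slices of an admissible quadruple *)

Section Quadruple.
Variables (R : realType) (X : ptopologicalType) (E : comBanachAlg R).
Variables (B : function_algebra X (@complex_nca R)) (Bt : function_algebra X E).
Hypothesis adm : admissible B Bt.

(** The product g . a, seen as an elementary tensor; [slice psi] contracts it to psi(a) g. *)
Definition tensor (g : B) (a : E) : Bt := fa_elt (adm_scale adm g a).

Definition slice (psi : characters E) (f : Bt) : B :=
  fa_elt (adm_comp adm f psi).

Lemma pt_eval_tensor x g a : pt_eval x (tensor g a) = (pt_eval x g : R[i]) *: a.
Proof. by []. Qed.

Lemma pt_eval_slice x psi f :
  pt_eval x (slice psi f) = gelfand (pt_eval x f) psi.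
Proof. by []. Qed.

Lemma tensor1E x a : pt_eval x (tensor 1 a) = a.
Proof. by rewrite pt_eval_tensor (_ : pt_eval x 1 = 1)// scale1r. Qed.

Lemma slice_unital_hom psi : unital_hom (slice psi).
Proof.
split=> [k f g|f g|]; apply: fa_ext => x.
- by rewrite pt_eval_slice [LHS]gelfandD gelfandZ.
- by rewrite pt_eval_slice [LHS]gelfandM.
- by rewrite pt_eval_slice [LHS]gelfand1.
Qed.

Lemma tensor1r_unital_hom : unital_hom (fun g => tensor g 1).
Proof.
split=> [k f g|f g|]; apply: fa_ext => x.
- by rewrite pt_eval_tensor [LHS]scalerDl -scalerA.
- by rewrite pt_eval_tensor [RHS]mulr_algl scalerA.
- by rewrite pt_eval_tensor [LHS]scale1r.
Qed.

Lemma tensor1l_unital_hom : unital_hom (tensor 1).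
Proof.
split=> [k a b|a b|]; apply: fa_ext => x.
- by rewrite [RHS](uhom_linear (pt_eval_unital_hom Bt x)) !tensor1E.
- by rewrite [RHS](uhom_mul (pt_eval_unital_hom Bt x)) !tensor1E.
- by rewrite tensor1E.
Qed.

Lemma slice_bounded psi :
  exists2 C, 0 <= C & forall f, nca_norm (slice psi f) <= C * nca_norm f.
Proof.
have [|||C C_ge0 CP] := @fa_uniform_bound _ _ _ B Bt (@fa_complete _ _ _ Bt)
  unit (fun=> slice psi).
- by move=> _; exact: uhom_linear (slice_unital_hom psi).
- move=> _ x; have [C _ CP] := pt_eval_bounded Bt x; exists C => f.
  exact: le_trans (character_bound _ _) (CP f).
- by move=> f; exists (nca_norm (slice psi f)).
by exists C => // f; exact: CP tt f.
Qed.

(** Separate boundedness gives joint boundedness: [tensorr] bounds the map in [g] for fixed [a], so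
    the maps in [a], indexed by the ball of radius [m] in [B], form a pointwise bounded family. *)
Lemma tensor_bounded (m : R) : exists2 C, 0 <= C & forall g a,
  nca_norm g <= m -> nca_norm (tensor g a) <= C * nca_norm a.
Proof.
have tensorr a : exists2 C, 0 <= C &
    forall g, nca_norm (tensor g a) <= C * nca_norm g.
  have [|||C C_ge0 CP] := @fa_uniform_bound _ _ _ Bt B (@fa_complete _ _ _ B)
    unit (fun _ g => tensor g a).
  - move=> _ k f g; apply: fa_ext => x.
    by rewrite pt_eval_tensor [LHS]scalerDl -scalerA.
  - move=> _ x; have [C _ CP] := pt_eval_bounded B x.
    exists (C * nca_norm a) => g.
    rewrite pt_eval_tensor nca_normZ mulrAC ler_wpM2r ?nca_norm_ge0//.
    exact: CP.
  - by move=> g; exists (nca_norm (tensor g a)).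
  by exists C => // g; exact: CP tt g.
have [|||C C_ge0 CP] := @fa_uniform_bound _ _ _ Bt E (@cba_complete _ E)
  {g : B | nca_norm g <= m} (fun g => tensor (sval g)).
- move=> g k a b; apply: fa_ext => x; rewrite pt_eval_tensor [LHS]scalerDr.
  by rewrite scalerA mulrC -scalerA.
- move=> g x; exists (Normc.normc (pt_eval x (sval g) : R[i])) => a.
  by rewrite pt_eval_tensor nca_normZ.
- move=> a; have [C C_ge0 CP] := tensorr a; exists (C * m) => -[g gm] /=.
  by rewrite (le_trans (CP g))// ler_wpM2l.
by exists C => // g a gm; exact: CP (exist _ g gm) a.
Qed.

Lemma gelfand_tensor_beta g a x psi :
  gelfand (tensor g a) (beta Bt (x, psi)) =
  (pt_eval x g : R[i]) * gelfand a psi.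
Proof. exact: gelfandZ. Qed.

End Quadruple.

Theorem theorem2 (R : realType) (X : ptopologicalType) (E : comBanachAlg R)
    (B : function_algebra X (@complex_nca R)) (Bt : function_algebra X E)
    (hnat : natural_quadruple B Bt) (hss : semisimple Bt) :
  bounded_relative_units Bt <->
    bounded_relative_units E /\ bounded_relative_units B.
Proof.
have [adm [betainv _ betaK]] := hnat.
split=> [bruBt|[bruE bruB]].
  split.
    (* Any base point serves: evaluation there has a |-> 1 . a as right inverse, so its transpose is
       injective. *)
    have [C C_ge0 CP] := pt_eval_bounded Bt point.
    apply: (bounded_relative_units_comap
      (Thom := pt_eval_unital_hom Bt point) C_ge0 CP _ bruBt).
    move=> psi psi' psipsi'; apply: character_ext => a.
    have := congr1 (gelfand (tensor adm 1 a)) psipsi'.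
    by rewrite !gelfand_comap tensor1E.
  (* Without characters of E, the bijection beta leaves Bt none either, and a
     semisimple Bt would be 0. *)
  have [psi _] : exists psi : characters E, True.
    apply: contrapT => noE; have /eqP := oner_neq0 Bt; apply.
    apply: hss; apply/funext => chi; exfalso; apply: noE.
    by exists (betainv chi).2.
  have [C C_ge0 CP] := slice_bounded adm psi.
  apply: (bounded_relative_units_comap
    (Thom := slice_unital_hom adm psi) C_ge0 CP _ bruBt).
  (* The slice has g |-> g . 1 as right inverse, since psi(1) = 1. *)
  move=> chi chi' chichi'; apply: character_ext => g.
  have := congr1 (gelfand (tensor adm g 1)) chichi'.
  rewrite !gelfand_comap (_ : slice adm psi (tensor adm g 1) = g)//.
  apply: fa_ext => x.
  by rewrite pt_eval_slice pt_eval_tensor gelfandZ gelfand1 mulr1.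
pose hB := comap (tensor1r_unital_hom adm).
pose hE := comap (tensor1l_unital_hom adm).
have hBE x psi (f := beta Bt (x, psi)) :
    (forall g, gelfand g (hB f) = pt_eval x g) /\ hE f = psi.
  split=> [g|].
    by rewrite gelfand_comap gelfand_tensor_beta gelfand1 mulr1.
  by apply: character_ext => a; rewrite gelfand_comap gelfand_tensor_beta mul1r.
apply: (@bounded_relative_units_join _ _ _ _ hB hE _ _ _ _ bruB bruE).
- exact: comap_continuous.
- exact: comap_continuous.
- move=> chi chi' hBE_eq.
  have hB_eq : hB chi = hB chi' := congr1 fst hBE_eq.
  have hE_eq : hE chi = hE chi' := congr1 snd hBE_eq.
  (* Both characters lie in the image of [beta]: [hE] recovers [psi], [hB] recovers evaluation at
     [x], and [B] separates points. *)
  move: hB_eq hE_eq; rewrite -[chi]betaK -[chi']betaK.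
  case: (betainv chi) (betainv chi') => [x psi] [x' psi'].
  have [hBx ->] := hBE x psi; have [hBx' ->] := hBE x' psi'.
  move=> hBxx' ->; congr (beta _ (_, _)); apply: contrapT.
  move=> /(@fa_separates _ _ _ B)[g]; by apply; rewrite -hBx -hBx' hBxx'.
(* [m] also bounds the norm of 1, because the summand 1 . a is estimated with the same [C]. *)
move=> m1 m2; set m := Num.max m1 (nca_norm (1 : B)).
have [C C_ge0 CP] := tensor_bounded adm m.
exists (C * nca_norm (1 : E) + C * m2 + C * m2) => g a gm1 am2.
(* This is 1 - (1 - g)(1 - a) expanded; the bound [C] applies to each of the three summands. *)
exists (tensor adm g 1 + tensor adm 1 a - tensor adm g a) => [chi|].
  rewrite -[chi]betaK.
  case: (betainv chi) => [x psi].
  have [hBx ->] := hBE x psi; rewrite hBx.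
  rewrite !gelfandD gelfandN !gelfand_tensor_beta.
  by rewrite gelfand1 (_ : pt_eval x 1 = 1)//; ring.
have gm : nca_norm g <= m by rewrite le_max gm1.
have m1' : nca_norm (1 : B) <= m by rewrite le_max lexx orbT.
rewrite (le_trans (nca_normD _ _))// nca_normN lerD//; last first.
  by rewrite (le_trans (CP g a gm))// ler_wpM2l.
rewrite (le_trans (nca_normD _ _))// lerD//; first exact: CP.
by rewrite (le_trans (CP 1 a _))// ler_wpM2l.
Qed.
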